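(* Consider an $S$-stage implicit L-stable Runge-Kutta (RK) method of order $p$ and stage order $q\le p-1$ satisfying the assumptions listed in the context. Let $0\le t_0<t$, $T=t-t_0$, and let $s_1,\dots,s_P\in\mathbb{C}$ with $\Re(s_\ell)\ge 0$. Let $g\in C^{\gamma}([0,T])$ with $\gamma\ge p$. Then there is a constant $C$, independent of $h$ and $g$, such that for every step size $h=T/N$, $N\in\mathbb{N}$, with $\max_{\ell}|s_\ell h|\le 1$, $$\left|E^{\max}_{\mathrm{RK}}(t)\right|\le C h^{p}\left(\sum_{l=0}^{p-1}|g^{(l)}(0)|+\max_{0\le\tau\le T}|g^{(p)}(\tau)|\right).$$
   Context: RK method: coefficients $\mathcal{A}=(a_{ij})_{S\times S}$, $\beta=(b_1,\dots,b_S)^T$, nodes $c_1,\dots,c_S$. ''Order $p$'' means the local truncation error is $O(h^{p+1})$ for smooth problems $y'=F(t,y)$, and ''stage order $q$'' means each internal stage has error $O(h^{q+1})$. Stability function: $r(z)=1+z\beta^T(I-z\mathcal{A})^{-1}\mathbf{1}$ with $\mathbf{1}=(1,\dots,1)^T$. Assumptions on the method: $b_j=a_{Sj}$ for $j=1,\dots,S$; $c_S=1$; all eigenvalues of $\mathcal{A}$ have positive real part; L-stability: $|r(z)|\le 1$ for $\Re(z)\le 0$ and $r(\infty)=0$. For each $\ell$, let $Y_\ell$ solve $Y_\ell'(\tau)=-s_\ell Y_\ell(\tau)+g(\tau)$ on $[0,T]$, $Y_\ell(0)=0$, and let $Y_\ell^n\approx Y_\ell(nh)$ be the RK approximation with step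 $h$, $Y_\ell^0=0$, $t_n=nh$: $$Y_\ell^{n+1}=Y_\ell^n+h\sum_{i=1}^S b_iK_i,\qquad K_i=-s_\ell\Big(Y_\ell^n+h\sum_{j=1}^S a_{ij}K_j\Big)+g(t_n+c_ih).$$ $E^{\ell}_{\mathrm{RK}}(t)=Y_\ell(T)-Y_\ell^{N}$ is the error of the RK method for the $\ell$-th ODE at the final time, and $E^{\max}_{\mathrm{RK}}(t)=\max_{1\le\ell\le P}|E^{\ell}_{\mathrm{RK}}(t)|$. The exponents $s_\ell$ do not depend on $h$ (they are $O(1)$). The constant $C$ may depend on $T$, the RK method and $\max_\ell|s_\ell|$. *)

(* Defs.v *)
From HB Require Import structures.
From mathcomp Require Import all_boot all_order all_algebra.
From mathcomp Require Import complex.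
From mathcomp Require Import all_classical all_reals all_analysis.

Set Implicit Arguments.
Unset Strict Implicit.
Unset Printing Implicit Defensive.

Import Order.TTheory GRing.Theory Num.Theory.
Import numFieldNormedType.Exports.

Local Open Scope classical_set_scope.
Local Open Scope complex_scope.
Local Open Scope ring_scope.

(* Real-valued modulus; the norm of the field R[i] takes its values in R[i]. *)
Notation cmod := Normc.normc.

(* Differentiation of complex-valued functions of a real variable, relative to
   a set D: at an end point of D = [a, b] this is the one-sided derivative, and
   the values of the function outside D are irrelevant. *)
Section DerivativeOn.
Variables (R : realType) (D : set R).

Definition slope (f : R -> R[i]) (x u : R) : R[i]^o :=
  (f u - f x) / (u - x)%:C.

Definition has_deriv_on (f : R -> R[i]) (x : R) (l : R[i]) : Prop :=
  slope f x u @[u --> within D x^'] --> (l : R[i]^o).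

Definition deriv_on (f : R -> R[i]) (x : R) : R[i] :=
  lim (slope f x u @[u --> within D x^']).

Definition derivn_on (k : nat) (f : R -> R[i]) : R -> R[i] :=
  iter k deriv_on f.

Definition Ck_on (k : nat) (f : R -> R[i]) : Prop :=
  (forall j x, (j < k)%N -> D x ->
     has_deriv_on (derivn_on j f) x (derivn_on j.+1 f x)) /\
  {within D, continuous (derivn_on k f : R -> R[i]^o)}.

End DerivativeOn.

(* On finite-dimensional spaces these are the usual classes C^k and C^oo. *)
Fixpoint Ck (R : realType) (U V : normedModType R) (k : nat) (f : U -> V)
    : Prop :=
  continuous f /\
  match k with
  | 0 => True
  | k'.+1 => forall v : U, (forall x, derivable f x v) /\
                           Ck k' (fun x => 'D_v f x)
  end.

Definition smooth (R : realType) (U V : normedModType R) (f : U -> V) : Prop :=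
  forall k, Ck k f.

Record RKmethod (R : Type) (S : nat) := RKMethod {
  rkA : 'M[R]_S;
  rkb : 'cV[R]_S;
  rkc : 'I_S -> R
}.

Section RungeKutta.
Variables (R : realType) (S : nat) (m : RKmethod R S).

Section Step.
Variable V : lmodType R.

Definition stage_value (h : R) (y : V) (K : 'I_S -> V) (i : 'I_S) : V :=
  y + h *: \sum_j rkA m i j *: K j.

Definition is_stages (F : R -> V -> V) (h t : R) (y : V) (K : 'I_S -> V)
    : Prop :=
  forall i, K i = F (t + rkc m i * h) (stage_value h y K i).

Definition step_value (h : R) (y : V) (K : 'I_S -> V) : V :=
  y + h *: \sum_i rkb m i 0 *: K i.

Definition is_RK_solution (F : R -> V -> V) (h : R) (N : nat) (y0 : V)
    (y : nat -> V) : Prop :=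
  y 0 = y0 /\
  forall n, (n < N)%N -> exists K : 'I_S -> V,
    is_stages F h (n%:R * h) (y n) K /\ y n.+1 = step_value h (y n) K.

End Step.

(* [err h y K] is O(h^(r+1)) for one step of the method started on the exact
   solution y of a smooth problem at time t0.  The stage equations of an
   implicit method may have spurious solutions that blow up as h -> 0 (backward
   Euler for y' = y^2 has one, of size 1/h^2); bounding K by an arbitrary
   constant B excludes these, and leaves at most one solution for h small. *)
Definition one_step_error_O (r : nat)
    (err : forall d : nat, (R -> 'rV[R]_d) -> R -> R -> ('I_S -> 'rV[R]_d) -> R)
    : Prop :=
  forall (d : nat) (F : R -> 'rV[R]_d -> 'rV[R]_d) (y : R -> 'rV[R]_d)
         (t0 delta : R),
    smooth (fun x : R^o * 'rV[R]_d => F x.1 x.2) ->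
    0 < delta ->
    (forall t : R, `|t - t0| < delta -> is_derive t (1 : R) y (F t (y t))) ->
    forall B : R, exists C h0 : R, 0 < h0 /\
      forall (h : R) (K : 'I_S -> 'rV[R]_d),
        0 < h -> h <= h0 ->
        (forall i, `|K i| <= B) ->
        is_stages F h t0 (y t0) K ->
        err d y t0 h K <= C * h ^+ r.+1.

Definition has_order (p : nat) : Prop :=
  one_step_error_O p (fun d y t0 h K =>
    `|y (t0 + h) - step_value h (y t0) K|).

Definition has_stage_order (q : nat) : Prop :=
  forall i : 'I_S, one_step_error_O q (fun d y t0 h K =>
    `|y (t0 + rkc m i * h) - stage_value h (y t0) K i|).

Definition rkAC : 'M[R[i]]_S := map_mx (fun x => x%:C) (rkA m).
Definition rkbC : 'cV[R[i]]_S := map_mx (fun x => x%:C) (rkb m).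

Definition stability_function (z : R[i]) : R[i] :=
  1 + z * (rkbC^T *m invmx (1%:M - z *: rkAC) *m (const_mx 1 : 'cV_S)) 0 0.

Definition L_stable : Prop :=
  (forall z : R[i], complex.Re z <= 0 -> cmod (stability_function z) <= 1) /\
  (forall e : R, 0 < e -> exists B : R, forall z : R[i],
     B < cmod z -> cmod (stability_function z) < e).

End RungeKutta.

Section ScalarTestProblem.
Variable R : realType.

(* [Rcomplex R] is R[i] seen as a vector space over R. *)
Definition linear_rhs (s : R[i]) (g : R -> R[i]) (t : R) (y : Rcomplex R)
    : Rcomplex R := (- s * y + g t : R[i]).

Definition is_ODE_solution (T : R) (s : R[i]) (g Y : R -> R[i]) : Prop :=
  Y 0 = 0 /\
  forall t : R, 0 <= t <= T ->
    has_deriv_on `[0, T] Y t (linear_rhs s g t (Y t)).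

Definition max_cmod (P : nat) (z : 'I_P -> R[i]) : R :=
  \big[Num.max/0]_(l < P) cmod (z l).

(* A maximum when f is continuous on [0, T]. *)
Definition sup_cmod (T : R) (f : R -> R[i]) : R :=
  sup [set cmod (f t) | t in `[0, T]].

End ScalarTestProblem.

(* Main.v *)
(** The error e_n = Y(t_n) - Y^n satisfies e_(n+1) = r(-s h) e_n + d_n with
    |r(-s h)| <= 1, so it suffices that the local error d_n is O(h^(p+1)).

    For a linear problem only the order conditions
    b^T A^j c^k = k! / (j + k + 1)!, j + k < p, matter; they follow from the
    order of the method on the chain y_0' = t^k, y_(l+1)' = y_l.  Write
    V_j = b^T A^j K, where K are the stages started on the exact solution and
    Y_0 = Y, Y_(k+1) = -s Y_k + g^(k) are its derivatives.  The stage equations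
    express V_j by V_(j+1) with a factor -s h, and downward induction on j
    starting from a bound on V_p shows that V_0 agrees with the Taylor sum of
    (Y(t_n + h) - Y(t_n)) / h up to O(h^p).  The bound on V_p needs
    (I + s h A)^-1 to be bounded uniformly for |s h| <= 1, Re s >= 0: the
    determinant is the product of the 1 - z mu over the eigenvalues mu, and
    |1 - z mu| >= Re mu / |mu| for Re z <= 0. *)

Require Import Defs.
From HB Require Import structures.
From mathcomp Require Import all_boot all_order all_algebra.
From mathcomp Require Import complex.
From mathcomp Require Import perm.
From mathcomp Require Import all_classical all_reals all_analysis.
From mathcomp Require Import ring lra.

Set Implicit Arguments.
Unset Strict Implicit.
Unset Printing Implicit Defensive.

Import Order.TTheory GRing.Theory Num.Theory.
Import numFieldNormedType.Exports.

Local Open Scope classical_set_scope.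
Local Open Scope complex_scope.
Local Open Scope ring_scope.

(** * Modulus and derivative of complex-valued functions *)

Section ComplexModulus.
Variable R : realType.
Implicit Types (x : R) (z w : R[i]).

Lemma cmod_ge0 z : 0 <= cmod z.
Proof. by case: z => a b; exact: sqrtr_ge0. Qed.

Lemma normcE_real z : `|z| = (cmod z)%:C.
Proof. by case: z => a b; rewrite normc_def. Qed.

Lemma cmodD z w : cmod (z + w) <= cmod z + cmod w.
Proof. exact: le_normcD. Qed.

Lemma cmodN z : cmod (- z) = cmod z.
Proof. exact: normcN. Qed.

Lemma cmodB z w : cmod (z - w) <= cmod z + cmod w.
Proof. by rewrite -(cmodN w) cmodD. Qed.

Lemma cmod_real x : cmod x%:C = `|x|.
Proof. by rewrite /= expr0n /= addr0 sqrtr_sqr. Qed.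

Lemma cmod_sum (I : Type) (r : seq I) (P : pred I) (F : I -> R[i]) :
  cmod (\sum_(i <- r | P i) F i) <= \sum_(i <- r | P i) cmod (F i).
Proof.
elim/big_rec2: _ => [|i y1 y2 _ le_y]; first by rewrite Normc.normc0.
by apply: le_trans (cmodD _ _) _; rewrite lerD2l.
Qed.

Lemma Re_le_cmod z : `|complex.Re z| <= cmod z.
Proof. by have := normc_ge_Re z; rewrite normcE_real lecR. Qed.

Lemma Im_le_cmod z : `|complex.Im z| <= cmod z.
Proof.
case: z => a b /=; rewrite -[leLHS]sqrtr_sqr; apply: ler_wsqrtr.
by rewrite lerDr sqr_ge0.
Qed.

Lemma cmod_le_ReIm z : cmod z <= `|complex.Re z| + `|complex.Im z|.
Proof.
case: z => a b /=; rewrite -[leRHS]ger0_norm ?addr_ge0 // -sqrtr_sqr.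
apply: ler_wsqrtr.
rewrite sqrrD !real_normK ?num_real // -addrA lerD2l lerDr mulrn_wge0 //.
Qed.

Lemma sqr_cmod z : cmod z ^+ 2 = complex.Re z ^+ 2 + complex.Im z ^+ 2.
Proof. by case: z => a b; rewrite sqr_sqrtr // addr_ge0 ?sqr_ge0. Qed.

Lemma Re_realM x z : complex.Re (x%:C * z) = x * complex.Re z.
Proof. by case: z => a b /=; rewrite mul0r subr0. Qed.

Lemma Im_realM x z : complex.Im (x%:C * z) = x * complex.Im z.
Proof. by case: z => a b /=; rewrite mul0r addr0. Qed.

Lemma scale_Rcomplex x (z : Rcomplex R) : x *: z = x%:C * z :> R[i].
Proof. by case: z => a b; rewrite /GRing.scale /= ; simpc. Qed.

End ComplexModulus.

(** * Derivatives of complex-valued functions relative to a set of reals *)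

Section DerivativeFacts.
Variable R : realType.
Implicit Types (D : set R) (f : R -> R[i]) (x : R) (l : R[i]).

(** Clearing the denominator of the difference quotient makes the estimate valid at [u = x] too and
    turns it into an inequality between reals. *)
Lemma has_deriv_on_dist D f x l e : has_deriv_on D f x l -> 0 < e ->
  exists2 d, 0 < d & forall u, D u -> `|u - x| < d ->
    cmod (f u - f x - (u - x)%:C * l) <= e * `|u - x|.
Proof.
move=> fxl e0.
have eC : (0 : R[i]) < e%:C by rewrite ltcR.
have /cvgrPdist_lt/(_ _ eC) := fxl.
rewrite /prop_near1/= /within/= => -[d /= d0 hd].
exists d => // u Du ux; have [->|neq] := eqVneq u x.
  by rewrite !subrr mul0r subrr Normc.normc0 normr0 mulr0.
have := hd u; rewrite /= distrC => /(_ ux neq Du).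
rewrite normcE_real ltcR => /ltW lt_e.
have nz : (u - x)%:C != 0 :> R[i].
  by rewrite (inj_eq (@complexI _)) subr_eq0.
have -> : f u - f x - (u - x)%:C * l = - ((u - x)%:C * (l - slope f x u)).
  by rewrite mulrBr /slope mulrCA divff // mulr1 opprB.
by rewrite cmodN Normc.normcM cmod_real mulrC ler_wpM2r.
Qed.

Lemma has_deriv_onD D f1 f2 x l1 l2 :
  has_deriv_on D f1 x l1 -> has_deriv_on D f2 x l2 ->
  has_deriv_on D (fun t => f1 t + f2 t) x (l1 + l2).
Proof.
move=> h1 h2; rewrite /has_deriv_on.
rewrite [X in X @ _ --> _](_ : _ = slope f1 x \+ slope f2 x).
  exact: (@cvgD _ (R[i]^o) _ _ _ (slope f1 x) (slope f2 x) l1 l2 h1 h2).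
by apply/funext => u /=; rewrite /slope -mulrDl opprD addrACA.
Qed.

Lemma has_deriv_onZ D f x l c :
  has_deriv_on D f x l -> has_deriv_on D (fun t => c * f t) x (c * l).
Proof.
move=> h; rewrite /has_deriv_on.
rewrite [X in X @ _ --> _](_ : _ = fun u => c * slope f x u).
  exact: (@cvgMr (R[i])).
by apply/funext => u /=; rewrite /slope mulrA mulrBr.
Qed.

Lemma has_deriv_on_continuous D f (df : R -> R[i]) :
  (forall x, D x -> has_deriv_on D f x (df x)) ->
  {within D, continuous (f : R -> R[i]^o)}.
Proof.
move=> hf; apply/subspace_continuousP => x Dx; apply/cvgrPdist_lt => e.
(* A positive element of [R[i]] has zero imaginary part, so the tolerance is real. *)
case: e => e e' /=; rewrite ltcE /= => /andP[/eqP -> e0].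
have [d d0 hd] := has_deriv_on_dist (hf x Dx) ltr01.
pose M := cmod (df x) + 1.
have M0 : 0 < M by rewrite ltr_wpDl // cmod_ge0.
exists (Num.min d (e / M)); first by rewrite /= lt_min d0 divr_gt0.
move=> u /=; rewrite lt_min distrC => /andP[ud ue] Du.
have := hd u Du ud; rewrite mul1r => fu.
have fuM : cmod (f u - f x) <= M * `|u - x|.
  have -> : f u - f x = (f u - f x - (u - x)%:C * df x) + (u - x)%:C * df x.
    by rewrite subrK.
  apply: le_trans (cmodD _ _) _.
  by rewrite Normc.normcM cmod_real /M mulrDl mul1r addrC [_ * cmod _]mulrC lerD2l.
rewrite distrC normcE_real ltcR; apply: le_lt_trans fuM _.
by rewrite mulrC -ltr_pdivlMr.
Qed.

Lemma within_continuous_lipschitz D f (L : R[i] -> R) :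
  (forall z w, `|L z - L w| <= cmod (z - w)) ->
  {within D, continuous (f : R -> R[i]^o)} -> {within D, continuous (L \o f)}.
Proof.
move=> Llip cf; apply/subspace_continuousP => x Dx; apply/cvgrPdist_lt => e e0.
have eC : (0 : R[i]) < e%:C by rewrite ltcR.
have /subspace_continuousP/(_ x Dx)/cvgrPdist_lt/(_ _ eC) := cf.
apply: filterS => u /=; rewrite normcE_real ltcR; apply: le_lt_trans.
exact: Llip.
Qed.

Section RealPart.
(* [L] is instantiated with the real and the imaginary part. *)
Variable L : R[i] -> R.
Hypothesis LB : forall z w, L (z - w) = L z - L w.
Hypothesis LZ : forall r z, L (r%:C * z) = r * L z.
Hypothesis L_le : forall z, `|L z| <= cmod z.

Lemma is_derive_has_deriv_on T f x l : 0 < x < T ->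
  has_deriv_on `[0, T] f x l -> is_derive x (1 : R) (L \o f) (L l).
Proof.
move=> /andP[x0 xT] hf.
suff Hf : h^-1 *: (((L \o f) \o shift x) h%:A - (L \o f) x) @[h --> 0^'] --> L l.
  have F1 : 'D_1 (L \o f) x = L l by apply: cvg_lim.
  by split=> //; apply: cvgP Hf.
apply/cvgrPdist_le => e e0.
have [d d0 hd] := has_deriv_on_dist hf e0.
(* The radius [Num.min x (T - x)] keeps [h + x] in [[0, T]], so the derivative relative to [[0, T]]
   is two-sided at [x]. *)
exists (Num.min d (Num.min x (T - x))).
  by rewrite /= !lt_min d0 x0 subr_gt0 xT.
move=> h /=; rewrite sub0r normrN !lt_min => /and3P[hd' hx hT] hn0.
have Du : `[0, T]%classic (h + x).
  rewrite /= in_itv /=; move: hx hT; rewrite !ltr_norml => /andP[? ?] /andP[? ?].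
  by apply/andP; split; lra.
have := hd (h + x) Du; rewrite addrK => /(_ hd') hle.
rewrite [_%:A]mulr1 distrC.
have -> : h^-1 *: (L (f (h + x)) - L (f x)) - L l =
   h^-1 * L (f (h + x) - f x - h%:C * l).
  by rewrite !LB LZ [RHS]mulrBr [h^-1 * (h * _)]mulrA mulVf // mul1r.
rewrite normrM normfV mulrC ler_pdivrMr ?normr_gt0 //.
exact: le_trans (L_le _) hle.
Qed.

End RealPart.

Lemma within_continuous_Re D f : {within D, continuous (f : R -> R[i]^o)} ->
  {within D, continuous (fun t => complex.Re (f t))}.
Proof.
apply: within_continuous_lipschitz => [[a b] [a' b']].
exact: Re_le_cmod ((a +i* b) - (a' +i* b')).
Qed.

Lemma within_continuous_Im D f : {within D, continuous (f : R -> R[i]^o)} ->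
  {within D, continuous (fun t => complex.Im (f t))}.
Proof.
apply: within_continuous_lipschitz => [[a b] [a' b']].
exact: Im_le_cmod ((a +i* b) - (a' +i* b')).
Qed.

Lemma is_derive_Re T f x l : 0 < x < T -> has_deriv_on `[0, T] f x l ->
  is_derive x (1 : R) (fun t => complex.Re (f t)) (complex.Re l).
Proof.
apply: (is_derive_has_deriv_on (L := @complex.Re R)) => [[? ?] [? ?]||] //.
  exact: Re_realM.
exact: Re_le_cmod.
Qed.

Lemma is_derive_Im T f x l : 0 < x < T -> has_deriv_on `[0, T] f x l ->
  is_derive x (1 : R) (fun t => complex.Im (f t)) (complex.Im l).
Proof.
apply: (is_derive_has_deriv_on (L := @complex.Im R)) => [[? ?] [? ?]||] //.
  exact: Im_realM.
exact: Im_le_cmod.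
Qed.

Lemma cmod_bounded_cont T f : 0 <= T ->
  {within `[0, T], continuous (f : R -> R[i]^o)} ->
  has_sup [set cmod (f t) | t in `[0, T]].
Proof.
move=> T0 cf.
have cm : {within `[0, T], continuous (fun t => cmod (f t))}.
  apply: within_continuous_lipschitz cf => z w.
  exact: (ler_dist_dist (z : Rcomplex R) (w : Rcomplex R)).
have [c cT hc] := EVT_max T0 cm.
split; first by exists (cmod (f 0)), 0 => //=; rewrite in_itv /= lexx T0.
by exists (cmod (f c)) => _ [t tT <-]; apply: hc.
Qed.

End DerivativeFacts.

(** * Taylor estimates on an interval *)

Section Taylor.
Variable R : realType.
Implicit Types (T M a b : R).

(* Iterated mean value theorem: the crude constant [M], without the [1 / n`!]
   of the sharp remainder, is all that is needed. *)
Lemma taylor_real T n (u : nat -> R -> R) M :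
  (forall k (x : R), (k < n)%N -> 0 < x < T -> is_derive x (1 : R) (u k) (u k.+1 x)) ->
  (forall k, (k < n)%N -> {within `[0, T], continuous (u k)}) ->
  (forall x, 0 <= x <= T -> `|u n x| <= M) ->
  forall a b, 0 <= a -> a <= b -> b <= T ->
  `|u 0 b - \sum_(k < n) (b - a) ^+ k / k`!%:R * u k a| <= M * (b - a) ^+ n.
Proof.
elim: n u => [|n IH] u du cu uM a b a0 ab bT.
  by rewrite big_ord0 subr0 expr0 mulr1 uM // bT (le_trans a0 ab).
(* As a polynomial, the Taylor sum has an algebraic derivative: the Taylor sum of the shifted family
   [u k.+1], to which the induction hypothesis applies. *)
pose Q : {poly R} := \sum_(k < n.+1) (u k a / k`!%:R) *: ('X - a%:P) ^+ k.
have QE x : Q.[x] = \sum_(k < n.+1) (x - a) ^+ k / k`!%:R * u k a.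
  rewrite horner_sum; apply: eq_bigr => k _.
  by rewrite hornerZ horner_exp !hornerE mulrC [RHS]mulrAC -mulrA.
have dQE x : Q^`().[x] = \sum_(k < n) (x - a) ^+ k / k`!%:R * u k.+1 a.
  rewrite /Q raddf_sum /= horner_sum big_ord_recl expr0 derivZ -polyC1 derivC.
  rewrite scaler0 horner0 add0r; apply: eq_bigr => k _.
  rewrite /= /bump leq0n add1n derivZ deriv_exp derivXsubC mul1r hornerZ hornerMn.
  rewrite horner_exp !hornerE /= factS natrM -[_ ^+ k *+ _]mulr_natr.
  have k1 : k`!%:R != 0 :> R by rewrite pnatr_eq0 -lt0n fact_gt0.
  have k2 : k.+1%:R != 0 :> R by rewrite pnatr_eq0.
  by move: k.+1%:R k`!%:R k2 k1 => c1 c2 k2 k1; field; rewrite k1 k2.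
have [||c] := @MVT_segment R (fun x => u 0 x - Q.[x]) (fun x => u 1 x - Q^`().[x]) a b ab.
- move=> x; rewrite in_itv /= => /andP[ax xb].
  apply: is_deriveB; apply: du => //.
  by rewrite (le_lt_trans a0 ax) (lt_le_trans xb bT).
- move=> x; apply: (@within_continuousB _ _ _ `[a, b]).
    apply: continuous_subspaceW (cu 0 _) => // y; rewrite /= !in_itv /=.
    by move=> /andP[ay yb]; rewrite (le_trans a0 ay) (le_trans yb bT).
  by apply: continuous_subspaceT => y; exact: continuous_horner.
rewrite in_itv /= => /andP[ac cb].
have -> : Q.[a] = u 0 a.
  rewrite QE big_ord_recl big1 => [|i _]; last by rewrite subrr expr0n /= !mul0r.
  by rewrite expr0 fact0 divr1 mul1r addr0.
rewrite subrr subr0 QE dQE => ->; rewrite normrM exprSr mulrA.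
rewrite (ger0_norm (x := b - a)) ?subr_ge0 // ler_wpM2r ?subr_ge0 //.
apply: le_trans (IH (fun k => u k.+1) _ _ uM a c a0 ac (le_trans cb bT)) _.
- by move=> k y kn; apply: du.
- by move=> k kn; apply: cu.
have M0 : 0 <= M by apply: le_trans (uM a _); rewrite ?a0 ?(le_trans ab bT).
by rewrite ler_wpM2l // lerXn2r ?nnegrE ?subr_ge0 // lerD2r.
Qed.

(** The mean value theorem fails for complex values, so real and imaginary parts are treated
    separately; the factor 2 comes from |z| <= |Re z| + |Im z|. *)
Lemma taylor_complex T n (f : nat -> R -> R[i]) M :
  (forall k (x : R), (k < n)%N -> 0 <= x <= T ->
     has_deriv_on `[0, T] (f k) x (f k.+1 x)) ->
  (forall x, 0 <= x <= T -> cmod (f n x) <= M) ->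
  forall a b, 0 <= a -> a <= b -> b <= T ->
  cmod (f 0 b - \sum_(k < n) ((b - a) ^+ k / k`!%:R)%:C * f k a)
    <= 2 * M * (b - a) ^+ n.
Proof.
move=> df fM a b a0 ab bT.
have dom k x : (k < n)%N -> `[0, T]%classic x ->
    has_deriv_on `[0, T] (f k) x (f k.+1 x).
  by move=> kn; rewrite /= in_itv /=; apply: df.
have dom' k x : (k < n)%N -> 0 < x < T ->
    has_deriv_on `[0, T] (f k) x (f k.+1 x).
  by move=> kn /andP[/ltW x0 /ltW xT]; apply: df; rewrite ?x0.
have re : forall k (x : R), (k < n)%N -> 0 < x < T ->
    is_derive x (1 : R) (fun t => complex.Re (f k t)) (complex.Re (f k.+1 x)).
  by move=> k x kn xT; apply: (is_derive_Re xT); apply: dom'.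
have im : forall k (x : R), (k < n)%N -> 0 < x < T ->
    is_derive x (1 : R) (fun t => complex.Im (f k t)) (complex.Im (f k.+1 x)).
  by move=> k x kn xT; apply: (is_derive_Im xT); apply: dom'.
have sumE (L : {additive R[i] -> R}) : (forall r z, L (r%:C * z) = r * L z) ->
    L (f 0 b - \sum_(k < n) ((b - a) ^+ k / k`!%:R)%:C * f k a) =
    L (f 0 b) - \sum_(k < n) (b - a) ^+ k / k`!%:R * L (f k a).
  by move=> LZ; rewrite raddfB raddf_sum; under eq_bigr do rewrite LZ.
have cre k : (k < n)%N -> {within `[0, T], continuous (fun t => complex.Re (f k t))}.
  by move=> kn; apply: within_continuous_Re (has_deriv_on_continuous (fun x => dom k x kn)).
have cim k : (k < n)%N -> {within `[0, T], continuous (fun t => complex.Im (f k t))}.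
  by move=> kn; apply: within_continuous_Im (has_deriv_on_continuous (fun x => dom k x kn)).
have bre x : 0 <= x <= T -> `|complex.Re (f n x)| <= M.
  by move=> xT; apply: le_trans (Re_le_cmod _) (fM x xT).
have bim x : 0 <= x <= T -> `|complex.Im (f n x)| <= M.
  by move=> xT; apply: le_trans (Im_le_cmod _) (fM x xT).
apply: le_trans (cmod_le_ReIm _) _.
have -> : 2 * M * (b - a) ^+ n = M * (b - a) ^+ n + M * (b - a) ^+ n by ring.
apply: lerD.
- have := taylor_real re cre bre a0 ab bT.
  by rewrite -(sumE (@complex.Re R : {additive _ -> _}) (@Re_realM R)).
- have := taylor_real im cim bim a0 ab bT.
  by rewrite -(sumE (@complex.Im R : {additive _ -> _}) (@Im_realM R)).
Qed.

End Taylor.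

(** * A priori bounds on the derivatives of the forcing and on the ODE solution *)

Section Bounds.
Variable R : realType.
Implicit Types (T M G t x : R) (s : R[i]).

(** Descent from order [p]: a derivative is its value at [0] plus an increment controlled by the
    next derivative over a length at most [T], so each step costs a factor [2 * T + 1]. *)
Lemma derivatives_bounded T p (f : nat -> R -> R[i]) M :
  (forall k x, (k < p)%N -> 0 <= x <= T ->
     has_deriv_on `[0, T] (f k) x (f k.+1 x)) ->
  (forall k, (k < p)%N -> cmod (f k 0) <= M) ->
  (forall x, 0 <= x <= T -> cmod (f p x) <= M) ->
  forall k x, (k <= p)%N -> 0 <= x <= T ->
  cmod (f k x) <= (2 * T + 1) ^+ p * M.
Proof.
move=> df f0 fp k x kp /[dup] xT /andP[x0 xleT].
have T0 := le_trans x0 xleT.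
have T1 : 1 <= 2 * T + 1 by lra.
have M0 : 0 <= M by apply: le_trans (cmod_ge0 _) (fp x xT).
suff H j : (j <= p)%N -> forall y, 0 <= y <= T ->
    cmod (f (p - j)%N y) <= (2 * T + 1) ^+ j * M.
  have := H (p - k)%N (leq_subr _ _) x xT; rewrite subKn // => /le_trans; apply.
  by rewrite ler_wpM2r // ler_weXn2l // leq_subr.
elim: j => [_ y yT|j IH jp y /andP[y0 yT]].
  by rewrite subn0 expr0 mul1r fp.
have E : ((p - j.+1).+1 = p - j)%N by rewrite subnSK.
have lt_p : (p - j.+1 < p)%N by rewrite ltn_subrL (leq_ltn_trans _ jp).
have dom i z : (i < 1)%N -> 0 <= z <= T ->
    has_deriv_on `[0, T] (f (p - j.+1 + i)%N) z (f (p - j.+1 + i.+1)%N z).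
  by case: i => // _ zT; rewrite addn0 addn1; apply: df.
have bnd z : 0 <= z <= T -> cmod (f (p - j.+1 + 1)%N z) <= (2 * T + 1) ^+ j * M.
  by move=> zT; rewrite addn1 E; apply: IH (ltnW jp) z zT.
have := taylor_complex dom bnd (lexx 0) y0 yT.
rewrite big_ord1 expr0 fact0 divr1 mul1r addn0 subr0 expr1 => le1.
have := f0 _ lt_p => le2.
have -> : f (p - j.+1)%N y = f (p - j.+1)%N y - f (p - j.+1)%N 0 + f (p - j.+1)%N 0.
  by rewrite subrK.
apply: le_trans (cmodD _ _) _; apply: le_trans (lerD le1 le2) _.
have B1 : 1 <= (2 * T + 1) ^+ j by rewrite exprn_ege1.
have BM : M <= (2 * T + 1) ^+ j * M by rewrite ler_peMl.
rewrite exprS; move: ((2 * T + 1) ^+ j) B1 BM => B B1 BM.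
have B0 : 0 <= B * M by apply: le_trans BM.
have : (B * M) * y <= (B * M) * T by rewrite ler_wpM2l.
lra.
Qed.

(* Energy estimate: [exp (- t) * |Y|^2] has derivative at most [|g|^2]. *)
Lemma ODE_solution_bound T s (g Y : R -> R[i]) G : 0 <= complex.Re s ->
  is_ODE_solution T s g Y ->
  (forall x, 0 <= x <= T -> cmod (g x) <= G) ->
  forall t, 0 <= t <= T -> cmod (Y t) <= (expR T * T + 1) * G.
Proof.
move=> s0 [Y0 dY] gG t /andP[t0 tT].
have T0 := le_trans t0 tT.
have G0 : 0 <= G by apply: le_trans (cmod_ge0 _) (gG 0 _); rewrite lexx.
pose u x := complex.Re (Y x); pose v x := complex.Im (Y x).
pose u' x := complex.Re (linear_rhs s g x (Y x)).
pose v' x := complex.Im (linear_rhs s g x (Y x)).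
pose W x := expR (- x) * (u x ^+ 2 + v x ^+ 2).
pose X x := u' x * u x + u' x * u x + (v' x * v x + v' x * v x) - (u x ^+ 2 + v x ^+ 2).
have domY x : `[0, T]%classic x -> has_deriv_on `[0, T] Y x (linear_rhs s g x (Y x)).
  by rewrite /= in_itv /=; apply: dY.
have subI : `[0, t] `<=` `[0, T].
  by move=> x; rewrite /= !in_itv /= => /andP[-> /le_trans->].
have cu := continuous_subspaceW subI (within_continuous_Re (has_deriv_on_continuous domY)).
have cv := continuous_subspaceW subI (within_continuous_Im (has_deriv_on_continuous domY)).
have [||c] := @MVT_segment R W (fun x => expR (- x) * X x) 0 t t0.
- move=> x; rewrite in_itv /= => /andP[x0 xt].
  have xT : 0 < x < T by rewrite x0 (lt_le_trans xt tT).
  have dYx : has_deriv_on `[0, T] Y x (linear_rhs s g x (Y x)).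
    by apply: dY; rewrite !ltW // (lt_le_trans xt tT).
  have du : is_derive x (1 : R) u (u' x) := is_derive_Re xT dYx.
  have dv : is_derive x (1 : R) v (v' x) := is_derive_Im xT dYx.
  have de : is_derive x (1 : R) (fun y => expR (- y)) (- expR (- x)).
    by apply: is_derive_eq; rewrite mulrN1.
  rewrite /W; apply: is_derive_eq.
  rewrite /X /GRing.scale /=; ring.
- have WE : W = (fun x => expR (- x)) \* (u \* u \+ v \* v).
    by apply/funext => x; rewrite /W /= !expr2.
  rewrite WE => x; apply: cvgM.
    apply: (@continuous_subspaceT _ _ _ (fun x => expR (- x))) => y.
    by apply: continuous_comp; [exact: opp_continuous|exact: continuous_expR].
  by apply: cvgD; apply: cvgM; [exact: cu|exact: cu|exact: cv|exact: cv].
rewrite in_itv /= subr0 => /andP[c0 ct].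
have W0 : W 0 = 0 by rewrite /W /u /v Y0 /= expr0n /= addr0 mulr0.
rewrite W0 subr0 => Wt.
(* Here [X] = -2 Re s |Y|^2 + 2 Re (conj Y g) - |Y|^2. The first term is nonpositive and the other
   two are at most |g|^2, because |Y - g|^2 >= 0. *)
have XG : X c <= G ^+ 2.
  have : cmod (g c) ^+ 2 <= G ^+ 2.
    by rewrite lerXn2r ?nnegrE ?cmod_ge0 // gG // c0 (le_trans ct tT).
  rewrite sqr_cmod; apply: le_trans.
  rewrite /X /u' /v' /u /v /linear_rhs.
  move: (Y c) (g c); clear - s0; case: s s0 => r i /= r0 [a b] [a' b'] /=.
  have := sqr_ge0 (a - a'); have := sqr_ge0 (b - b').
  have := mulr_ge0 r0 (sqr_ge0 a); have := mulr_ge0 r0 (sqr_ge0 b).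
  rewrite !expr2 => *; nra.
have Wle : W t <= T * G ^+ 2.
  have e1 : expR (- c) <= 1 by rewrite -expR0 ler_expR oppr_le0.
  rewrite Wt mulrC; apply: le_trans (_ : t * G ^+ 2 <= _); last first.
    by rewrite ler_wpM2r ?sqr_ge0.
  rewrite ler_wpM2l //.
  apply: le_trans (_ : expR (- c) * G ^+ 2 <= _).
    by rewrite ler_wpM2l // expR_ge0.
  by rewrite ler_piMl // sqr_ge0.
have sqY : cmod (Y t) ^+ 2 <= expR T * T * G ^+ 2.
  have -> : cmod (Y t) ^+ 2 = expR t * W t.
    by rewrite /W mulrA -expRD subrr expR0 mul1r sqr_cmod.
  rewrite -mulrA ler_pM ?expR_ge0 ?ler_expR //.
  by rewrite /W mulr_ge0 ?expR_ge0 ?addr_ge0 ?sqr_ge0.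
have K0 : 0 <= expR T * T by rewrite mulr_ge0 ?expR_ge0.
(* Squares are compared: K <= (K + 1)^2 for K = [expR T * T], so no square root appears in the
   constant. *)
rewrite -(@ler_pXn2r _ 2) ?nnegrE ?cmod_ge0 ?mulr_ge0 ?addr_ge0 //.
apply: le_trans sqY _; rewrite exprMn ler_wpM2r ?sqr_ge0 //.
move: (expR T * T) K0 => K K0; rewrite expr2; nra.
Qed.

End Bounds.

(** * Uniform bound on the resolvent *)

(** Leibniz formula: one signed product of [n] entries for each permutation. *)
Lemma norm_det_le (F : numDomainType) n (A : 'M[F]_n) (M : F) :
  (forall i j, `|A i j| <= M) -> `|\det A| <= n`!%:R * M ^+ n.
Proof.
move=> AM; apply: le_trans (ler_norm_sum _ _ _) _.
have -> : n`!%:R * M ^+ n = \sum_(s : 'S_n) M ^+ n.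
  by rewrite sumr_const card_Sn mulr_natl.
apply: ler_sum => s _; rewrite normrM normrX normrN1 expr1n mul1r normr_prod.
rewrite -[n in M ^+ n]card_ord -prodr_const.
by apply: ler_prod => i _; rewrite normr_ge0 AM.
Qed.

Section ResolventBound.
Variables (R : realType) (S : nat) (A : 'M[R[i]]_S.+1).
Hypothesis eigenvalues_pos : forall mu : R[i], eigenvalue A mu -> 0 < complex.Re mu.

Definition resolvent (z : R[i]) : 'M[R[i]]_S.+1 := invmx (1%:M - z *: A).

Lemma prodr_const_seq (F : comPzRingType) (T : Type) (r : seq T) (x : F) :
  \prod_(i <- r) x = x ^+ size r.
Proof. by rewrite big_const_seq count_predT iter_mulr_1. Qed.

Lemma det_resolvent_ge : exists2 d : R, 0 < d &
  forall z : R[i], complex.Re z <= 0 -> d <= cmod (\det (1%:M - z *: A)).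
Proof.
have [r rE] := closed_field_poly_normal (char_poly A).
have /eqP lc : lead_coef (char_poly A) == 1 by rewrite -monicE char_poly_monic.
rewrite lc scale1r in rE.
have size_r : size r = S.+1.
  by apply: succn_inj; rewrite -(size_char_poly A) rE size_prod_XsubC.
have rpos l : l \in r -> 0 < complex.Re l.
  by move=> lr; apply: eigenvalues_pos; rewrite eigenvalue_root_char rE root_prod_XsubC.
pose d : R := \prod_(l <- r) (complex.Re l / cmod l).
have cmod_pos l : l \in r -> 0 < cmod l.
  by move=> /rpos l0; apply: lt_le_trans l0 (le_trans (ler_norm _) (Re_le_cmod _)).
have d0 : 0 < d.
  by rewrite /d big_seq; apply: prodr_gt0 => l lr; rewrite divr_gt0 ?rpos ?cmod_pos.
(* The minimum with [1] covers [z = 0], where the determinant is [1]; the factorization used for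
   other [z] divides by [z]. *)
exists (Num.min d 1); first by rewrite lt_min d0 ltr01.
move=> z z0.
have [->|zn0] := eqVneq z 0.
  by rewrite scale0r subr0 det1 Normc.normc1 ge_min lexx orbT.
have -> : \det (1%:M - z *: A) = \prod_(l <- r) (1 - z * l).
  (* The determinant is z^(S+1) chi(1/z), with chi the characteristic polynomial; the power of z is
     shared out among its S+1 roots. *)
  have -> : 1%:M - z *: A = z *: (z^-1%:M - A).
    by rewrite scalerBr scale_scalar_mx divff.
  rewrite detZ -[\det _](_ : (char_poly A).[z^-1] = _); last first.
    rewrite /char_poly -horner_evalE -det_map_mx; congr (\det _).
    by apply/matrixP => i j; rewrite !mxE /= horner_evalE !hornerE hornerMn hornerX.
  rewrite rE horner_prod -size_r -prodr_const_seq -big_split /=.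
  by apply: eq_bigr => l _; rewrite !hornerE mulrBr divff.
rewrite ge_min; apply/orP; left.
have -> : cmod (\prod_(l <- r) (1 - z * l)) = \prod_(l <- r) cmod (1 - z * l).
  by rewrite (big_morph _ (@Normc.normcM _) (Normc.normc1 _)).
rewrite /d [leLHS]big_seq [leRHS]big_seq; apply: ler_prod => l lr.
have l0 := ltW (rpos _ lr); have l1 := ltW (cmod_pos _ lr).
rewrite divr_ge0 //=.
rewrite ler_pdivrMr ?cmod_pos //.
(* Multiplying 1 - z l by conj l gives conj l - z |l|^2, whose real part is at least Re l since Re z
   <= 0. *)
have <- : cmod (conjc l) = cmod l by case: (l) => a b /=; rewrite sqrrN.
rewrite -Normc.normcM; apply: le_trans (Re_le_cmod _); apply: le_trans (ler_norm _).
move: (rpos _ lr); case: (l) (z) z0 => a b [x y] /= x0 a0.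
have := mulr_le0_ge0 x0 (sqr_ge0 a); have := mulr_le0_ge0 x0 (sqr_ge0 b).
rewrite !expr2; lra.
Qed.

Lemma unitmx_resolvent z : complex.Re z <= 0 -> 1%:M - z *: A \in unitmx.
Proof.
have [d d0 dle] := det_resolvent_ge => z0; rewrite unitmxE unitfE.
by apply: contraTneq (lt_le_trans d0 (dle z z0)) => ->; rewrite Normc.normc0 ltxx.
Qed.

(** Cramer's rule: an entry is a cofactor divided by the determinant, which is bounded away from 0.
    The condition |z| <= 1 serves to bound the cofactors. *)
Lemma resolvent_bounded : exists M : R,
  forall z : R[i], complex.Re z <= 0 -> cmod z <= 1 ->
    forall i j, cmod (resolvent z i j) <= M.
Proof.
have [d d0 dle] := det_resolvent_ge.
pose a : R := \sum_i \sum_j cmod (A i j).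
have aA i j : cmod (A i j) <= a.
  rewrite /a (bigD1 i) //= (bigD1 j) //= -addrA lerDl addr_ge0 ?sumr_ge0 // => *.
    exact: cmod_ge0.
  by rewrite sumr_ge0 // => *; exact: cmod_ge0.
have a0 : 0 <= a := le_trans (cmod_ge0 _) (aA 0 0).
(* A cofactor is, up to sign, a determinant of size [S] with entries at most [1 + a]. *)
pose B : R := S`!%:R * (1 + a) ^+ S.
exists (d^-1 * B) => z z0 z1 i j; rewrite /resolvent /invmx unitmx_resolvent // !mxE.
rewrite Normc.normcM Normc.normcV; apply: ler_pM; rewrite ?invr_ge0 ?cmod_ge0 //.
  by rewrite lef_pV2 ?posrE ?dle // (lt_le_trans d0) ?dle.
rewrite -lecR -normcE_real /cofactor normrM normrX normrN1 expr1n mul1r.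
have -> : B%:C = S`!%:R * (1 + a%:C) ^+ S :> R[i].
  by rewrite /B rmorphM rmorphXn rmorphD rmorph1 rmorph_nat.
apply: norm_det_le => k l; rewrite !mxE normcE_real -[1]/(1%:C) -rmorphD lecR.
apply: le_trans (cmodB _ _) _; apply: lerD.
  by case: eqP => _; rewrite ?Normc.normc1 // Normc.normc0.
by rewrite Normc.normcM -[a]mul1r ler_pM ?cmod_ge0.
Qed.

End ResolventBound.

(** * Local error *)

Section LocalError.
Variables (R : realType) (S p : nat) (m : RKmethod R S.+1).
Implicit Types (T h a X L : R) (lam : R[i]).

Let A := rkAC m.
Let b := rkbC m.

Definition stage_weights j : 'rV[R[i]]_S.+1 := b^T *m A ^+ j.

Definition stage_forcing (g : R -> R[i]) a h : 'cV[R[i]]_S.+1 :=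
  \col_i g (a + rkc m i * h).

Definition stage_equations lam h (y : R[i]) (G K : 'cV[R[i]]_S.+1) :=
  K = (lam * h%:C) *: (A *m K) + (lam * y) *: const_mx 1 + G.

Hypothesis order_conditions : forall j k, (j + k < p)%N ->
  \sum_i stage_weights j 0 i * (rkc m i)%:C ^+ k = k`!%:R / (j + k).+1`!%:R.
Hypothesis nodes_in_01 : forall i, 0 <= rkc m i <= 1.

Definition weights_norm : R :=
  \sum_(j < p.+1) \sum_i cmod (stage_weights j 0 i).

Lemma weights_norm_ge j : (j <= p)%N ->
  \sum_i cmod (stage_weights j 0 i) <= weights_norm.
Proof.
move=> jp; rewrite /weights_norm (bigD1 (Ordinal (jp : (j < p.+1)%N))) //= lerDl.
by rewrite sumr_ge0 // => k _; rewrite sumr_ge0 // => i _; exact: cmod_ge0.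
Qed.

Lemma weights_norm_ge0 : 0 <= weights_norm.
Proof. by rewrite sumr_ge0 // => k _; rewrite sumr_ge0 // => i _; exact: cmod_ge0. Qed.

(** The stage equations multiplied on the left by the row b^T A^j. *)
Lemma stage_functional_rec lam h y G K j : stage_equations lam h y G K ->
  \sum_i stage_weights j 0 i * K i 0 =
  lam * h%:C * (\sum_i stage_weights j.+1 0 i * K i 0)
  + lam * y * (\sum_i stage_weights j 0 i)
  + \sum_i stage_weights j 0 i * G i 0.
Proof.
move=> KE.
have VE n (V : 'cV_S.+1) : \sum_i stage_weights n 0 i * V i 0 = (stage_weights n *m V) 0 0.
  by rewrite mxE.
have -> : stage_weights j.+1 = stage_weights j *m A.
  by rewrite /stage_weights exprSr mulmxA.
rewrite !VE {1}KE !mulmxDr -!scalemxAr mulmxA !mxE; congr (_ + _ * _ + _).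
by apply: eq_bigr => i _; rewrite !mxE mulr1.
Qed.

(** * One step from the exact value [f 0 a], with [f k] and [g k] in the role of the derivatives of
    solution and forcing *)

Section OneStep.
Variables (M : R) (T h a lam_bound X : R) (lam : R[i]) (f g : nat -> R -> R[i]).
Variable K : 'cV[R[i]]_S.+1.
Hypotheses (h0 : 0 <= h) (a0 : 0 <= a) (ahT : a + h <= T).
Hypothesis lam_le : cmod lam <= lam_bound.
Hypothesis f_rec : forall k x, f k.+1 x = lam * f k x + g k x.
Hypothesis dg : forall k x, (k < p)%N -> 0 <= x <= T ->
  has_deriv_on `[0, T] (g k) x (g k.+1 x).
Hypothesis df : forall k x, (k < p.+1)%N -> 0 <= x <= T ->
  has_deriv_on `[0, T] (f k) x (f k.+1 x).
Hypothesis g_le : forall k x, (k <= p)%N -> 0 <= x <= T -> cmod (g k x) <= X.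
Hypothesis f_le : forall x, 0 <= x <= T -> cmod (f p.+1 x) <= X.
Hypothesis KE : stage_equations lam h (f 0 a) (stage_forcing (g 0) a h) K.
Hypothesis K_le : forall i, cmod (K i 0) <= M * X.

(** The start bounds b^T A^p K without any cancellation. Each step multiplies by [L], the bound on
    [lam], and adds a weighted Taylor remainder of the forcing, whose constant is 2. *)
Definition stage_const L j : R :=
  iter j (fun c => L * c + 2 * weights_norm) (weights_norm * M).

(* Downward induction on the power of [A]: the defect of
   [b^T A^(p-j) K] gains one power of [h] at each step, since
   [f (k+1) = lam f k + g k] reproduces the recursion of the Taylor sums. *)
Lemma stage_functional_error j : (j <= p)%N ->
  cmod (\sum_i stage_weights (p - j) 0 i * K i 0 -
        \sum_(k < j) (h ^+ k / (p - j + k).+1`!%:R)%:C * f k.+1 a)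
    <= stage_const lam_bound j * X * h ^+ j.
Proof.
elim: j => [_|j IH jp].
  rewrite subn0 big_ord0 subr0 expr0 mulr1 /stage_const /= -mulrA.
  apply: le_trans (cmod_sum _ _ _) _.
  apply: le_trans (_ : \sum_i cmod (stage_weights p 0 i) * (M * X) <= _).
    by apply: ler_sum => i _; rewrite Normc.normcM ler_wpM2l ?cmod_ge0.
  rewrite -mulr_suml ler_wpM2r ?weights_norm_ge //.
  exact: le_trans (cmod_ge0 _) (K_le 0).
set n := (p - j.+1)%N; have nE : (p - j = n.+1)%N by rewrite /n subnSK.
have nk k : (k < j.+1)%N -> (n + k < p)%N.
  by move=> kj; rewrite /n -[X in (_ < X)%N](subnK jp) ltn_add2l.
have := IH (ltnW jp); rewrite nE => {}IH.
set V := \sum_i stage_weights n.+1 0 i * K i 0 in IH.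
(* The Taylor remainder of the forcing at the [i]-th node. As nodes lie in [[0, 1]], the evaluation
   point stays in [[0, T]]. *)
pose r i := g 0 (a + rkc m i * h) -
  \sum_(k < j.+1) ((rkc m i * h) ^+ k / k`!%:R)%:C * g k a.
have r_le i : cmod (r i) <= 2 * X * h ^+ j.+1.
  have /andP[c0 c1] := nodes_in_01 i.
  have ch0 : 0 <= rkc m i * h by rewrite mulr_ge0.
  have ch1 : rkc m i * h <= h by rewrite ler_piMl.
  have ab : a <= a + rkc m i * h by rewrite lerDl.
  have bT : a + rkc m i * h <= T by apply: le_trans ahT; rewrite lerD2l.
  have dg' k x : (k < j.+1)%N -> 0 <= x <= T -> has_deriv_on `[0, T] (g k) x (g k.+1 x).
    by move=> kj; apply: dg; apply: leq_trans jp.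
  have := taylor_complex dg' (fun x => g_le jp) a0 ab bT.
  rewrite (_ : a + rkc m i * h - a = rkc m i * h); last by rewrite addrC addKr.
  rewrite -/(r i) => /le_trans; apply.
  rewrite ler_wpM2l ?lerXn2r ?nnegrE // mulr_ge0 //.
  by apply: le_trans (cmod_ge0 (g 0 a)) (g_le _ _); rewrite ?a0 // (le_trans ab).
(* The defect for [n] is [lam * h%:C] times the defect for [n.+1], plus weighted remainders; this
   factor gains the power of [h]. *)
have -> : \sum_i stage_weights n 0 i * K i 0 -
    \sum_(k < j.+1) (h ^+ k / (n + k).+1`!%:R)%:C * f k.+1 a =
    lam * h%:C * (V - \sum_(k < j) (h ^+ k / (n.+1 + k).+1`!%:R)%:C * f k.+1 a)
    + \sum_i stage_weights n 0 i * r i.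
  rewrite (stage_functional_rec n KE) -/V.
  have -> : \sum_i stage_weights n 0 i = (n.+1`!%:R)^-1.
    have := order_conditions (nk 0%N isT); rewrite addn0 fact0 div1r => <-.
    by apply: eq_bigr => i _; rewrite expr0 mulr1.
  have -> : \sum_i stage_weights n 0 i * r i =
      \sum_i stage_weights n 0 i * stage_forcing (g 0) a h i 0
      - \sum_(k < j.+1) (h ^+ k / (n + k).+1`!%:R)%:C * g k a.
    under eq_bigr do rewrite mulrBr; rewrite sumrB; congr (_ - _).
      by apply: eq_bigr => i _; rewrite [stage_forcing _ _ _ _ _]mxE.
    under eq_bigr do rewrite mulr_sumr; rewrite exchange_big /=.
    apply: eq_bigr => k _.
    under eq_bigr do rewrite mulrA; rewrite -mulr_suml; congr (_ * _).
    have := order_conditions (nk k (ltn_ord k)) => oc.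
    transitivity ((h%:C ^+ k / k`!%:R) * \sum_i stage_weights n 0 i * (rkc m i)%:C ^+ k).
      rewrite mulr_sumr; apply: eq_bigr => i _.
      by rewrite rmorphM rmorphXn rmorphM exprMn fmorphV rmorph_nat; ring.
    rewrite oc rmorphM rmorphXn fmorphV rmorph_nat.
    by rewrite mulrA mulfVK // pnatr_eq0 -lt0n fact_gt0.
  set GS := \sum_i stage_weights n 0 i * _.
  (* After this splitting the [g k] parts match on both sides, the part with [f 0 a] cancels the
     initial-value term, and the remaining [lam * f k a] parts form the previous Taylor sum shifted
     by one index. *)
  under [X in _ - X = _]eq_bigr do rewrite f_rec mulrDr.
  rewrite big_split /= big_ord_recl /= addn0 expr0 div1r fmorphV rmorph_nat.
  rewrite mulrBr.
  have -> : lam * h%:C * (\sum_(k < j) (h ^+ k / (n.+1 + k).+1`!%:R)%:C * f k.+1 a)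
      = \sum_(k < j) (h ^+ bump 0 k / (n + bump 0 k).+1`!%:R)%:C * (lam * f (bump 0 k) a).
    rewrite mulr_sumr; apply: eq_bigr => k _.
    rewrite /bump leq0n add1n addnS -addSn exprS -[h * _ / _]mulrA rmorphM /=; ring.
  ring.
apply: le_trans (cmodD _ _) _.
rewrite /stage_const iterS -/(stage_const lam_bound j) 2!mulrDl; apply: lerD.
  rewrite !Normc.normcM cmod_real ger0_norm // exprS.
  have -> : lam_bound * stage_const lam_bound j * X * (h * h ^+ j) =
     (lam_bound * h) * (stage_const lam_bound j * X * h ^+ j) by ring.
  by rewrite ler_pM ?mulr_ge0 ?cmod_ge0 // ler_wpM2r.
apply: le_trans (cmod_sum _ _ _) _.
apply: le_trans (_ : \sum_i cmod (stage_weights n 0 i) * (2 * X * h ^+ j.+1) <= _).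
  by apply: ler_sum => i _; rewrite Normc.normcM ler_wpM2l ?cmod_ge0.
have -> : 2 * weights_norm * X * h ^+ j.+1 = weights_norm * (2 * X * h ^+ j.+1) by ring.
rewrite -mulr_suml ler_wpM2r ?weights_norm_ge ?leq_subr //.
exact: le_trans (cmod_ge0 (r 0)) (r_le 0).
Qed.

(** Combines the case [j = p] of the induction, where the weights are those of b^T, with the Taylor
    expansion of the solution to order [p.+1]; the summand 2 is the constant of the latter. *)
Lemma local_error :
  cmod (f 0 (a + h) - f 0 a - h%:C * \sum_i b i 0 * K i 0)
    <= (2 + stage_const lam_bound p) * X * h ^+ p.+1.
Proof.
have err := stage_functional_error (leqnn p); rewrite subnn in err.
have w0 i : stage_weights 0 0 i = b i 0.
  by rewrite /stage_weights expr0 mulmx1 mxE.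
under eq_bigr do rewrite -w0.
have ab : a <= a + h by rewrite lerDl.
have := taylor_complex df f_le a0 ab ahT.
rewrite (_ : a + h - a = h); last by rewrite addrC addKr.
set V := \sum_i _ in err *; set Q := \sum_(k < p) _ in err => tay.
have -> : f 0 (a + h) - f 0 a - h%:C * V =
   (f 0 (a + h) - \sum_(k < p.+1) (h ^+ k / k`!%:R)%:C * f k a) - h%:C * (V - Q).
  rewrite big_ord_recl expr0 fact0 divr1 mul1r mulrBr.
  have -> : h%:C * Q = \sum_(i < p) (h ^+ (bump 0 i) / (bump 0 i)`!%:R)%:C * f (bump 0 i) a.
    rewrite mulr_sumr; apply: eq_bigr => k _.
    by rewrite /bump leq0n add1n add0n mulrA -rmorphM exprS mulrA.
  by ring.
apply: le_trans (cmodB _ _) _; rewrite 2!mulrDl lerD //.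
rewrite Normc.normcM cmod_real ger0_norm // exprS.
by rewrite mulrCA ler_wpM2l.
Qed.

End OneStep.
End LocalError.

(** * Smoothness of the test problem *)

Section DirectionalDerivatives.
Variables (R : realType) (U V : normedModType R).

Lemma is_derive_affine (f : U -> V) x v w :
  (forall h : R, f (h *: v + x) - f x = h *: w) -> is_derive x v f w.
Proof.
move=> fE.
have cvg_w : h^-1 *: ((f \o shift x) (h *: v) - f x) @[h --> 0^'] --> w.
  apply: (cvg_near_cst w); near=> h.
  rewrite /= fE scalerA mulVf ?scale1r //.
  by near: h; exact: nbhs_dnbhs_neq.
by split; [apply: cvgP cvg_w | apply: cvg_lim => //; exact: cvg_w].
Unshelve. all: by end_near. Qed.

Lemma is_derive_scalel (k : U -> R) (dk : R) (e : V) x v :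
  is_derive x v k dk -> is_derive x v (fun y => k y *: e) (dk *: e).
Proof.
move=> [dkx <-].
have cvg_e : h^-1 *: (((fun y => k y *: e) \o shift x) (h *: v) - k x *: e)
    @[h --> 0^'] --> 'D_v k x *: e.
  rewrite [X in X @ _ --> _](_ : _ = fun h : R =>
    (h^-1 *: ((k \o shift x) (h *: v) - k x)) *: e); last first.
    by apply/funext => h; rewrite /= -scalerBl scalerA.
  exact: cvgZr_tmp.
by split; [apply: cvgP cvg_e | apply: cvg_lim => //; exact: cvg_e].
Qed.

End DirectionalDerivatives.

Section SmoothProblem.
Variables (R : realType) (d : nat).
Implicit Types (a e : 'rV[R]_d) (N : 'M[R]_d) (c : R).

Lemma mulmxr_continuous N : continuous (fun y : 'rV[R]_d => y *m N).
Proof.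
move=> y; apply: differentiable_continuous.
rewrite (_ : (fun y => y *m N) = \sum_(i < d) (fun y : 'rV_d => y 0 i *: row i N)); last first.
  by apply/funext => z; rewrite mulmx_sum_row fct_sumE.
apply: differentiable_sum => i; apply: differentiableZl.
exact: differentiable_coord.
Qed.

Lemma linear_plus_monomial_continuous a N c k e :
  continuous (fun x : R^o * 'rV[R]_d => a + x.2 *m N + (c * x.1 ^+ k) *: e).
Proof.
move=> x; apply: cvgD.
  apply: cvgD; first exact: cvg_cst.
  apply: (@continuous_comp _ _ _ snd (fun y : 'rV[R]_d => y *m N)).
    exact: cvg_snd.
  exact: mulmxr_continuous.
have ck : continuous (fun t : R => c * t ^+ k).
  by move=> t; apply: cvgM; [exact: cvg_cst|exact: exprn_continuous].
apply: (@cvgZr_tmp R).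
apply: (@continuous_comp _ _ _ fst (fun t : R => c * t ^+ k)); last exact: ck.
exact: cvg_fst.
Qed.

(* Induction on [n] works because the family is closed under directional
   derivatives. *)
Lemma Ck_linear_plus_monomial n a N c k e :
  Ck n (fun x : R^o * 'rV[R]_d => a + x.2 *m N + (c * x.1 ^+ k) *: e).
Proof.
elim: n a N c k => [|n IH] a N c k.
  by split=> //; exact: linear_plus_monomial_continuous.
split; first exact: linear_plus_monomial_continuous.
move=> v.
(* The derivative along [v] is written as a member of the family, with matrix [0] and exponent
   [k.-1]. For [k = 0] the coefficient [k%:R] vanishes, so the truncated predecessor is harmless. *)
have dG (x : R^o * 'rV[R]_d) : is_derive x v
    (fun x : R^o * 'rV[R]_d => a + x.2 *m N + (c * x.1 ^+ k) *: e)
    (v.2 *m N + x.2 *m 0 + (c * k%:R * v.1 * x.1 ^+ k.-1) *: e).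
  apply: is_deriveD.
    rewrite mulmx0 addr0; apply: is_derive_affine => h /=.
    by rewrite mulmxDl -scalemxAl opprD addrACA subrr add0r addrK.
  apply: is_derive_scalel.
  have d1 : is_derive x v (fun x : R^o * 'rV[R]_d => x.1 : R) (v.1 : R).
    by apply: is_derive_affine => h /=; rewrite addrK.
  case: k => [|k].
    rewrite mulr0 !mul0r.
    rewrite (_ : (fun _ => _) = cst c); first exact: is_derive_cst.
    by apply/funext => y; rewrite expr0 mulr1.
  have -> : (fun x : R^o * 'rV[R]_d => c * x.1 ^+ k.+1) =
     c *: ((fun x : R^o * 'rV[R]_d => x.1 : R) ^+ k.+1).
    by apply/funext => y; rewrite /= !fctE.
  apply: is_derive_eq; rewrite /GRing.scale /=; ring.
split; first by move=> x; have [] := dG x.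
have -> : (fun x => 'D_v (fun x : R^o * 'rV[R]_d => a + x.2 *m N + (c * x.1 ^+ k) *: e) x)
  = (fun x => v.2 *m N + x.2 *m 0 + (c * k%:R * v.1 * x.1 ^+ k.-1) *: e).
  by apply/funext => x; apply: derive_val.
exact: IH.
Qed.

End SmoothProblem.

(** * Order conditions *)

Section OrderConditions.
Variables (R : realType) (S : nat) (m : RKmethod R S.+1).

Lemma entry_le_norm n (x : 'rV[R]_n) j : `|x 0 j| <= `|x|.
Proof.
rewrite [leRHS]/Num.Def.normr /= mx_normrE.
exact: (le_bigmax _ (fun ij : 'I_1 * 'I_n => `|x ij.1 ij.2|) (0, j)).
Qed.

Lemma norm_row_le n (x : 'rV[R]_n) B : 0 <= B -> (forall j, `|x 0 j| <= B) -> `|x| <= B.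
Proof.
move=> B0 xB; rewrite [leLHS]/Num.Def.normr /= mx_normrE bigmax_le // => -[i j] _.
by rewrite ord1 xB.
Qed.

Definition power_column k : 'cV[R]_S.+1 := \col_i rkc m i ^+ k.

(* The chain [y_0' = t^k], [y_(l+1)' = y_l] turns the elementary weight
   [b^T A^j c^k] into the [j]-th component of one step from [0]. *)
Section Chain.
Variables j k : nat.

(** The nilpotent shift: right multiplication moves each component one place up the chain. *)
Let N : 'M[R]_j.+1 := \matrix_(i, l) (i.+1 == l)%:R.

(** The neutral [0 +] and [1 *] give it the literal shape of the family shown smooth above. *)
Definition chain_rhs (t : R) (y : 'rV[R]_j.+1) : 'rV[R]_j.+1 :=
  0 + y *m N + (1 * t ^+ k) *: delta_mx 0 0.

(** The coefficient left by integrating [t ^+ k] from [0], [l.+1] times. *)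
Definition chain_coef l : R := k`!%:R / (k + l).+1`!%:R.

Definition chain_sol (t : R) : 'rV[R]_j.+1 :=
  \row_l (chain_coef l * t ^+ (k + l).+1).

Definition stage_coef l i : R := (rkA m ^+ l *m power_column k) i 0.

Lemma stage_coef0 i : stage_coef 0 i = rkc m i ^+ k.
Proof. by rewrite /stage_coef expr0 mul1mx mxE. Qed.

Lemma stage_coefS l i : stage_coef l.+1 i = \sum_i' rkA m i i' * stage_coef l i'.
Proof.
have E : rkA m ^+ l.+1 *m power_column k = rkA m *m (rkA m ^+ l *m power_column k).
  by rewrite exprS mulmxA.
by rewrite /stage_coef E mxE.
Qed.

Definition chain_stages (h : R) (i : 'I_S.+1) : 'rV[R]_j.+1 :=
  \row_l (h ^+ (k + l) * stage_coef l i).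

Lemma chain_rhs0 t y : chain_rhs t y 0 0 = t ^+ k.
Proof.
rewrite /chain_rhs !mxE !eqxx mulr1 mul1r add0r big1 ?add0r // => i _.
by rewrite mxE mulr0.
Qed.

Lemma chain_rhsS t y (l l' : 'I_j.+1) : l = l'.+1 :> nat -> chain_rhs t y 0 l = y 0 l'.
Proof.
move=> ll'; rewrite /chain_rhs !mxE add0r (bigD1 l') //= !mxE ll' eqxx mulr1.
have -> : (l == 0) = false by apply/eqP => l0; move: ll'; rewrite l0.
rewrite ?andbF /= mulr0 addr0 big1 ?addr0 // => i il'.
by rewrite mxE ll' eqSS (inj_eq val_inj) (negPf il') mulr0.
Qed.

Lemma chain_coef_rec l : chain_coef l.+1 * (k + l).+2%:R = chain_coef l.
Proof.
rewrite /chain_coef addnS factS natrM invfM mulrA mulrAC mulfVK // pnatr_eq0.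
Qed.

Lemma chain_coef0 : chain_coef 0 * k.+1%:R = 1.
Proof.
rewrite /chain_coef addn0 factS natrM mulrC mulrA divff // -natrM pnatr_eq0 -factS -lt0n fact_gt0.
Qed.

Lemma chain_sol_deriv t : is_derive t (1 : R) chain_sol (chain_rhs t (chain_sol t)).
Proof.
have dcomp (l : 'I_j.+1) :
    is_derive t (1 : R) (fun x => chain_sol x 0 l) (chain_rhs t (chain_sol t) 0 l).
  have -> : (fun x => chain_sol x 0 l) = chain_coef l *: (@id R ^+ (k + l).+1).
    by apply/funext => x; rewrite mxE !fctE.
  apply: is_derive_eq.
  rewrite /GRing.scale /= mulr1.
  have [l' /= ll'|l0] := pickP (fun l' : 'I_j.+1 => l == l'.+1 :> nat).
    rewrite (chain_rhsS _ _ (eqP ll')) mxE (eqP ll') addnS mulrA.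
    by rewrite chain_coef_rec.
  have -> : l = 0.
    apply/val_inj => /=; case: l l0 => -[//|l lj] /= /(_ (Ordinal (ltnW lj))).
    by rewrite eqxx.
  by rewrite chain_rhs0 addn0 mulrA chain_coef0 mul1r.
have drv : derivable chain_sol t 1.
  by apply/derivable_mxP => i l; rewrite ord1; have [] := dcomp l.
split=> //; rewrite derive_mx //; apply/rowP => l; rewrite mxE.
exact: derive_val.
Qed.

(** Each component depends only on the preceding one and the start is [0], so the implicit equations
    unwind explicitly, with one factor [h] and one factor [rkA m] per component. *)
Lemma chain_stagesP h : is_stages m chain_rhs h 0 (chain_sol 0) (chain_stages h).
Proof.
move=> i; apply/rowP => l; rewrite mxE add0r.
have [l' /= ll'|l0] := pickP (fun l' : 'I_j.+1 => l == l'.+1 :> nat).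
  rewrite (chain_rhsS _ _ (eqP ll')) (eqP ll') /stage_value !mxE expr0n /= mulr0 add0r.
  rewrite stage_coefS addnS exprS -mulrA; congr (_ * _).
  rewrite mulr_sumr summxE; apply: eq_bigr => i' _.
  by rewrite !mxE mulrCA.
have -> : l = 0.
  apply/val_inj => /=; case: l l0 => -[//|l lj] /= /(_ (Ordinal (ltnW lj))).
  by rewrite eqxx.
by rewrite chain_rhs0 addn0 stage_coef0 exprMn mulrC.
Qed.

Lemma chain_step h : step_value m h (chain_sol 0) (chain_stages h) 0 ord_max =
  h ^+ (k + j).+1 * ((rkb m)^T *m rkA m ^+ j *m power_column k) 0 0.
Proof.
have -> : (rkb m)^T *m rkA m ^+ j *m power_column k =
  (rkb m)^T *m (rkA m ^+ j *m power_column k) by rewrite mulmxA.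
have -> : ((rkb m)^T *m (rkA m ^+ j *m power_column k)) 0 0 =
    \sum_i rkb m i 0 * stage_coef j i.
  by rewrite mxE; apply: eq_bigr => i _; rewrite mxE.
rewrite /step_value !mxE expr0n /= mulr0 add0r summxE exprS -mulrA; congr (_ * _).
by rewrite mulr_sumr; apply: eq_bigr => i _; rewrite !mxE mulrCA.
Qed.

(** Needed because [has_order] only covers stages bounded independently of [h]. *)
Lemma chain_stages_bounded : exists B : R,
  forall h, 0 < h <= 1 -> forall i, `|chain_stages h i| <= B.
Proof.
pose w i (l : 'I_j.+1) : R := `|stage_coef l i|.
exists (\sum_i \sum_l w i l) => h /andP[h0 h1] i.
have w0 i' : 0 <= \sum_l w i' l by apply: sumr_ge0 => l _; exact: normr_ge0.
apply: norm_row_le => [|l]; first by apply: sumr_ge0 => i' _.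
rewrite mxE normrM (bigD1 i) //= (bigD1 l) //= -addrA.
apply: le_trans (_ : w i l <= _).
  by rewrite ler_piMl // normrX ger0_norm ?(ltW h0) // exprn_ile1 // ltW.
by rewrite lerDl addr_ge0 ?sumr_ge0 // => l' _; exact: normr_ge0.
Qed.

End Chain.

(** In the last component of the chain, exact and numerical values are both multiples of h^(j+k+1).
    Their difference is at most C h^(p+1) with j+k+1 <= p, so letting h tend to 0 forces equal
    coefficients. *)
Lemma order_condition p j k : has_order m p -> (j + k < p)%N ->
  ((rkb m)^T *m rkA m ^+ j *m power_column k) 0 0 = k`!%:R / (j + k).+1`!%:R.
Proof.
move=> ord jkp; have [B KB] := chain_stages_bounded j k.
have [||C [h0 [h0_gt0 err]]] := ord j.+1 (chain_rhs (j := j) k) (chain_sol j k) 0 1 _ ltr01 _ B.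
- by move=> n; exact: (Ck_linear_plus_monomial n 0 _ 1 k (delta_mx 0 0)).
- by move=> t _; exact: chain_sol_deriv.
set q := (_ *m _) 0 0; set beta := _ / _; apply/eqP; rewrite eq_sym -subr_eq0.
apply/negPn/negP => nz.
have nz0 : 0 < `|beta - q| by rewrite normr_gt0.
(* Small enough that |beta - q| <= |C| h is contradictory; [C] may be negative, hence [|C| + 1]. *)
pose h := Num.min (Num.min h0 1) (`|beta - q| / (`|C| + 1)).
have C1 : 0 < `|C| + 1 by rewrite ltr_wpDl.
have hgt0 : 0 < h by rewrite !lt_min h0_gt0 ltr01 divr_gt0.
have hh0 : h <= h0 by rewrite !ge_min lexx.
have h1 : h <= 1 by rewrite !ge_min lexx orbT.
have hb : h * (`|C| + 1) <= `|beta - q| by rewrite -ler_pdivlMr // !ge_min lexx orbT.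
have hB i : `|chain_stages j k h i| <= B by apply: KB; rewrite hgt0.
have := err h _ hgt0 hh0 hB (@chain_stagesP j k h).
move=> /(le_trans (entry_le_norm _ ord_max)).
rewrite mxE [X in `|_ + X|]mxE chain_step mxE add0r -/q /chain_coef.
rewrite (addnC k j) -/beta mulrC -mulrBr normrM normrX (ger0_norm (ltW hgt0)).
move=> herr; have Cle : C <= `|C| := ler_norm C.
have hp : h ^+ p.+1 <= h ^+ (j + k).+2 by rewrite ler_wiXn2l ?(ltW hgt0).
have : h ^+ (j + k).+1 * `|beta - q| <= h ^+ (j + k).+1 * (`|C| * h).
  apply: le_trans herr _; rewrite mulrCA -exprSr.
  apply: le_trans (ler_wpM2r (exprn_ge0 _ (ltW hgt0)) Cle) _.
  by rewrite ler_wpM2l.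
rewrite ler_pM2l ?exprn_gt0 // => contra.
by move: hb; rewrite mulrDr mulr1; move: contra; rewrite mulrC; lra.
Qed.

End OrderConditions.

(** * Global error *)

Section GlobalError.
Variables (R : realType) (S p : nat) (m : RKmethod R S.+1).

Lemma complex_order_condition j k : has_order m p -> (j + k < p)%N ->
  \sum_i stage_weights m j 0 i * (rkc m i)%:C ^+ k = k`!%:R / (j + k).+1`!%:R.
Proof.
move=> ord jkp.
have -> : stage_weights m j = map_mx (real_complex R) ((rkb m)^T *m rkA m ^+ j).
  by rewrite /stage_weights /rkbC /rkAC map_mxM map_trmx rmorphXn.
transitivity ((((rkb m)^T *m rkA m ^+ j *m power_column m k) 0 0)%:C).
  rewrite mxE rmorph_sum; apply: eq_bigr => i _.
  by rewrite [power_column _ _ _ _]mxE [map_mx _ _ _ _]mxE rmorphM rmorphXn.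
by rewrite (order_condition ord jkp) rmorphM fmorphV !rmorph_nat.
Qed.

(** The derivatives of [Y] as given by the equation, not by limits, so that the recursion in [k]
    holds by computation at every point. *)
Fixpoint ode_deriv (lam : R[i]) (g : nat -> R -> R[i]) (Y : R -> R[i]) k : R -> R[i] :=
  if k is k'.+1 then fun x => lam * ode_deriv lam g Y k' x + g k' x else Y.

(** The solution has one derivative more than the forcing, hence [k <= n] against [k < n]. *)
Lemma ode_deriv_has_deriv T s g Y n :
  (forall k x, (k < n)%N -> 0 <= x <= T -> has_deriv_on `[0, T] (g k) x (g k.+1 x)) ->
  is_ODE_solution T s (g 0) Y ->
  forall k x, (k <= n)%N -> 0 <= x <= T ->
    has_deriv_on `[0, T] (ode_deriv (- s) g Y k) x (ode_deriv (- s) g Y k.+1 x).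
Proof.
move=> dg [_ dY]; elim=> [|k IH] x kn xT; first exact: dY.
apply: has_deriv_onD; last exact: dg.
by apply: has_deriv_onZ; apply: IH => //; exact: ltnW.
Qed.

Lemma ode_deriv_bound L T lam g Y n Xg C :
  cmod lam <= L -> 1 <= C ->
  (forall k x, (k < n)%N -> 0 <= x <= T -> cmod (g k x) <= Xg) ->
  (forall x, 0 <= x <= T -> cmod (Y x) <= C * Xg) ->
  forall k x, (k <= n)%N -> 0 <= x <= T ->
    cmod (ode_deriv lam g Y k x) <= (L + 1) ^+ k * (C * Xg).
Proof.
move=> lamL C1 gX YX; elim=> [|k IH] x kn xT; first by rewrite expr0 mul1r YX.
have L0 : 0 <= L := le_trans (cmod_ge0 _) lamL.
have gk := gX k x kn xT.
have X0 : 0 <= Xg := le_trans (cmod_ge0 _) gk.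
apply: le_trans (cmodD _ _) _; rewrite exprS mulrDl mul1r [leRHS]mulrDl.
apply: lerD.
  rewrite Normc.normcM -mulrA; apply: ler_pM; rewrite ?cmod_ge0 //.
  by apply: IH => //; exact: ltnW.
apply: le_trans gk _; rewrite mulrA ler_peMl //.
by rewrite mulr_ege1 // exprn_ege1 // lerDr.
Qed.

Lemma resolvent_solution lam h y G K :
  1%:M - (lam * h%:C) *: rkAC m \in unitmx ->
  stage_equations m lam h y G K ->
  K = resolvent (rkAC m) (lam * h%:C) *m ((lam * y) *: const_mx 1 + G).
Proof.
move=> U KE; apply: (can_inj (mulKmx U)).
rewrite /resolvent mulKVmx // mulmxBl mul1mx -scalemxAl.
by apply/eqP; rewrite subr_eq {1}KE -addrA addrC.
Qed.

Lemma stage_equations_resolvent lam h y G :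
  1%:M - (lam * h%:C) *: rkAC m \in unitmx ->
  stage_equations m lam h y G
    (resolvent (rkAC m) (lam * h%:C) *m ((lam * y) *: const_mx 1 + G)).
Proof.
move=> U; rewrite /stage_equations; set K := _ *m _.
have : (1%:M - (lam * h%:C) *: rkAC m) *m K = (lam * y) *: const_mx 1 + G.
  by rewrite /K /resolvent mulKVmx.
by rewrite mulmxBl mul1mx -scalemxAl -addrA => <-; rewrite addrCA subrr addr0.
Qed.

Lemma resolvent_stages_bound M lam h y (G : 'cV[R[i]]_S.+1) L X :
  (forall i j, cmod (resolvent (rkAC m) (lam * h%:C) i j) <= M) ->
  cmod lam <= L -> cmod y <= X -> (forall i, cmod (G i 0) <= X) ->
  forall i, cmod ((resolvent (rkAC m) (lam * h%:C) *m
    ((lam * y) *: const_mx 1 + G)) i 0) <= S.+1%:R * (M * (L + 1)) * X.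
Proof.
move=> rM lamL yX GX i; rewrite mxE.
apply: le_trans (cmod_sum _ _ _) _.
rewrite -mulrA mulr_natl -[X in _ *+ X](card_ord S.+1) -sumr_const.
apply: ler_sum => j _; rewrite Normc.normcM -mulrA.
apply: ler_pM; rewrite ?cmod_ge0 //.
rewrite !mxE mulr1 mulrDl mul1r; apply: le_trans (cmodD _ _) _.
by rewrite lerD // Normc.normcM ler_pM ?cmod_ge0.
Qed.

(** Both stage systems share the forcing [G], so [K] and [Kn] differ by the resolvent applied to a
    multiple of [y - yn]; with the update this yields the stability function. *)
Lemma RK_step_error lam h y yn G K Kn d :
  1%:M - (lam * h%:C) *: rkAC m \in unitmx ->
  stage_equations m lam h y G K -> stage_equations m lam h yn G Kn ->
  y + d - (yn + h%:C * \sum_i rkbC m i 0 * Kn i 0) =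
  (d - h%:C * \sum_i rkbC m i 0 * K i 0)
    + stability_function m (lam * h%:C) * (y - yn).
Proof.
move=> U KE KnE.
have VE (V : 'cV_S.+1) : \sum_i rkbC m i 0 * V i 0 = ((rkbC m)^T *m V) 0 0.
  by rewrite [RHS]mxE; apply: eq_bigr => i _; rewrite [(rkbC m)^T _ _]mxE.
have -> : \sum_i rkbC m i 0 * Kn i 0 = \sum_i rkbC m i 0 * K i 0
    - lam * (y - yn) * ((rkbC m)^T *m resolvent (rkAC m) (lam * h%:C)
                          *m (const_mx 1 : 'cV_S.+1)) 0 0.
  have -> : Kn = K - (lam * (y - yn)) *: (resolvent (rkAC m) (lam * h%:C) *m const_mx 1).
    rewrite (resolvent_solution U KE) (resolvent_solution U KnE) scalemxAr -mulmxBr.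
    by rewrite addrAC -scalerBl mulrBr subKr.
  by rewrite !VE mulmxBr -scalemxAr mulmxA !mxE.
rewrite /stability_function /resolvent; ring.
Qed.

End GlobalError.

(** * Accumulation of the local errors and the final estimate *)

Section Convergence.
Variables (R : realType) (S p : nat) (m : RKmethod R S.+1).
Hypothesis order_p : has_order m p.
Hypothesis nodes_in_01 : forall i, 0 <= rkc m i <= 1.
Hypothesis stable : forall z : R[i], complex.Re z <= 0 -> cmod (stability_function m z) <= 1.
Hypothesis resolvent_unit : forall z : R[i], complex.Re z <= 0 ->
  1%:M - z *: rkAC m \in unitmx.
Variable M : R.
Hypothesis resolvent_le : forall z : R[i], complex.Re z <= 0 -> cmod z <= 1 ->
  forall i j, cmod (resolvent (rkAC m) z i j) <= M.

Definition local_const (L : R) : R :=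
  2 + stage_const p m (S.+1%:R * (M * (L + 1))) L p.

Definition solution_const (T L : R) : R := (L + 1) ^+ p.+1 * (expR T * T + 1).

Lemma RK_stage_equations s (g : R -> R[i]) h t (y : Rcomplex R) (K : 'I_S.+1 -> Rcomplex R) :
  is_stages m (linear_rhs s g) h t y K ->
  stage_equations m (- s) h y (stage_forcing m g t h) (\col_i K i).
Proof.
move=> KE; apply/colP => i; rewrite mxE {1}KE /linear_rhs /stage_value !mxE.
rewrite scale_Rcomplex mulr1 mulrDr; congr (_ + _).
rewrite addrC mulrA; congr (_ + _); congr (_ * _).
by apply: eq_bigr => j _; rewrite scale_Rcomplex !mxE.
Qed.

(** At most [N] local errors of size h^(p+1) add up, and [N%:R * h = T] trades one power of [h] for
    [T]. *)
Lemma RK_global_error T L Xg s (g : nat -> R -> R[i]) Y Yh N :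
  0 < T -> (0 < N)%N -> 0 <= complex.Re s -> cmod s <= L ->
  let h := T / N%:R in
  cmod (s * h%:C) <= 1 ->
  (forall k x, (k < p)%N -> 0 <= x <= T ->
     has_deriv_on `[0, T] (g k) x (g k.+1 x)) ->
  (forall k x, (k <= p)%N -> 0 <= x <= T -> cmod (g k x) <= Xg) ->
  is_ODE_solution T s (g 0) Y ->
  is_RK_solution m (linear_rhs s (g 0)) h N 0 Yh ->
  cmod (Y T - Yh N) <= T * local_const L * solution_const T L * h ^+ p * Xg.
Proof.
move=> T0 N0 s0 sL h sh1 dg gX ode [Yh0 Yhstep].
have N0R : 0 < N%:R :> R by rewrite ltr0n.
have h0 : 0 <= h by rewrite divr_ge0 // ltW.
have Nh : N%:R * h = T by rewrite mulrC divfK // gt_eqF.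
have L0 : 0 <= L := le_trans (cmod_ge0 _) sL.
have X0 : 0 <= Xg by apply: le_trans (cmod_ge0 _) (gX 0%N 0 _ _); rewrite // lexx ltW.
set CY := expR T * T + 1.
have CY1 : 1 <= CY by rewrite lerDr mulr_ge0 ?expR_ge0 // ltW.
pose X := solution_const T L * Xg.
pose z := - s * h%:C.
have z0 : complex.Re z <= 0.
  by rewrite /z mulrC Re_realM raddfN mulrN oppr_le0 mulr_ge0.
have z1 : cmod z <= 1 by rewrite /z mulNr cmodN.
pose f := ode_deriv (- s) g Y.
have df := ode_deriv_has_deriv dg ode.
have YX := ODE_solution_bound s0 ode (fun x => gX 0%N x isT).
have lamL : cmod (- s) <= L by rewrite cmodN.
have fX k x : (k <= p.+1)%N -> 0 <= x <= T -> cmod (f k x) <= X.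
  move=> kp xT; apply: le_trans (ode_deriv_bound (n := p.+1) lamL CY1 gX YX kp xT) _.
  have CYX : 0 <= CY * Xg by rewrite mulr_ge0 // (le_trans ler01).
  by rewrite /X /solution_const -mulrA ler_wpM2r // ler_weXn2l // lerDr.
have gX' k x : (k <= p)%N -> 0 <= x <= T -> cmod (g k x) <= X.
  move=> kp xT; apply: le_trans (gX k x kp xT) _.
  rewrite ler_peMl // mulr_ege1 // exprn_ege1 // lerDr //.
pose D := local_const L * X * h ^+ p.+1.
suff H n : (n <= N)%N -> cmod (Y (n%:R * h) - Yh n) <= n%:R * D.
  have := H N (leqnn N); rewrite Nh => /le_trans; apply.
  rewrite /D /X exprS -[X in _ <= X * _ * _ * _ * _]Nh.
  by rewrite le_eqVlt; apply/orP; left; apply/eqP; ring.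
elim: n => [_|n IH nN]; first by rewrite mul0r ode.1 Yh0 subrr Normc.normc0 mul0r.
have [Kn [/RK_stage_equations KnE ->]] := Yhstep n nN.
set a := n%:R * h in KnE *.
have a0 : 0 <= a by rewrite mulr_ge0.
have anE : n.+1%:R * h = a + h by rewrite -addn1 natrD mulrDl mul1r.
have ahT : a + h <= T by rewrite -anE -Nh ler_wpM2r // ler_nat.
have aT : 0 <= a <= T by rewrite a0 (le_trans _ ahT) // lerDl.
have U := resolvent_unit z0.
pose G := stage_forcing m (g 0) a h.
(* The stages started on the exact solution are not part of the numerical run; the resolvent
   supplies them. *)
have KE := stage_equations_resolvent (Y a) G U.
set K := resolvent _ _ *m _ in KE.
have GX i : cmod (G i 0) <= X.
  rewrite mxE; apply: gX' => //; have /andP[c0 c1] := nodes_in_01 i.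
  apply/andP; split; first by rewrite addr_ge0 // mulr_ge0.
  by apply: le_trans ahT; rewrite lerD2l ler_piMl.
have KX := resolvent_stages_bound (resolvent_le z0 z1) lamL (fX 0%N a isT aT) GX.
have loc := local_error (fun j k => complex_order_condition order_p) nodes_in_01 h0 a0 ahT
  lamL (f := f) (fun k x => erefl) dg df gX' (fun x => fX p.+1 x (leqnn _)) KE KX.
rewrite anE /step_value scale_Rcomplex.
have -> : \sum_i rkb m i 0 *: Kn i = \sum_i rkbC m i 0 * (\col_i (Kn i : R[i])) i 0.
  by apply: eq_bigr => i _; rewrite scale_Rcomplex !mxE.
rewrite -[Y (a + h)](subrKC (Y a)) (RK_step_error (Y (a + h) - Y a) U KE KnE).
apply: le_trans (cmodD _ _) _.
have -> : n.+1%:R * D = D + n%:R * D by rewrite -natr1 mulrDl mul1r addrC.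
apply: lerD; first exact: loc.
(* The stability function has modulus at most 1 at [z], so the inherited error is not amplified. *)
rewrite Normc.normcM; apply: le_trans (IH (ltnW nN)).
by rewrite ler_piMl ?cmod_ge0 // stable.
Qed.

Lemma local_const_ge0 L : 0 <= L -> 0 <= local_const L.
Proof.
have M0 : 0 <= M.
  apply: le_trans (cmod_ge0 _) (resolvent_le (z := 0) _ _ 0 0) => //.
  by rewrite Normc.normc0.
have W0 := weights_norm_ge0 p m; move=> L0.
have M'0 : 0 <= S.+1%:R * (M * (L + 1)) by rewrite !mulr_ge0 // addr_ge0.
rewrite /local_const addr_ge0 // /stage_const.
elim: {1}p => [|j IH]; first exact: mulr_ge0.
by rewrite iterS addr_ge0 // mulr_ge0 // mulr_ge0.
Qed.

End Convergence.

(** Continuity on the compact interval bounds the set, so [sup] is a true least upper bound and not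
    a default value. *)
Lemma sup_cmod_ge (R : realType) T (f : R -> R[i]) x : 0 <= x <= T ->
  {within `[0, T], continuous (f : R -> R[i]^o)} -> cmod (f x) <= sup_cmod T f.
Proof.
move=> xT cf; have T0 : 0 <= T by case/andP: xT; apply: le_trans.
by apply: ub_le_sup; [exact: (cmod_bounded_cont T0 cf).2 | exists x].
Qed.

Theorem theorem3p1 (R : realType) (S p q : nat) (m : RKmethod R S.+1)
  (order_p : has_order m p)
  (stage_order_q : has_stage_order m q)
  (q_le_p1 : (q + 1 <= p)%N)
  (stiffly_accurate : forall j, rkb m j 0 = rkA m ord_max j)
  (last_node : rkc m ord_max = 1)
  (eigenvalues_pos : forall mu : R[i],
     eigenvalue (rkAC m) mu -> 0 < complex.Re mu)
  (Lstable : L_stable m)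
  (nodes_in_01 : forall i, 0 <= rkc m i <= 1) :
  exists C : R -> R -> R,
  forall (t0 t : R), 0 <= t0 -> t0 < t ->
  let T := t - t0 in
  forall (P : nat) (s : 'I_P -> R[i]), (forall l, 0 <= complex.Re (s l)) ->
  forall (gamma : nat) (g : R -> R[i]),
    (p <= gamma)%N -> Ck_on `[0, T] gamma g ->
  forall N : nat, (0 < N)%N ->
  let h := T / N%:R in
  max_cmod (fun l => s l * h%:C) <= 1 ->
  forall (Y : 'I_P -> R -> R[i]) (Yh : 'I_P -> nat -> R[i]),
    (forall l, is_ODE_solution T (s l) g (Y l)) ->
    (forall l, is_RK_solution m (linear_rhs (s l) g) h N 0 (Yh l)) ->
  let E := fun l => Y l T - Yh l N in
  `|max_cmod E| <=
    C T (max_cmod s) * h ^+ p *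
      (\sum_(0 <= l < p) cmod (derivn_on `[0, T] l g 0)
         + sup_cmod T (derivn_on `[0, T] p g)).
Proof.
have [M resolvent_le] := resolvent_bounded eigenvalues_pos.
(* The factor [(2 * T + 1) ^+ p] comes from bounding all derivatives of [g] by the data; the others
   come from the global error. [M] depends on the method only. *)
pose C T L := T * local_const p m M L * solution_const p T L * (2 * T + 1) ^+ p.
exists C => t0 t _ t0t T P s s0 gamma g p_gamma [dg cg] N N0 h sh1 Y Yh ode rk /=.
have T0 : 0 < T by rewrite subr_gt0.
pose gd k := derivn_on `[0, T] k g.
have dgd k x : (k < gamma)%N -> 0 <= x <= T ->
    has_deriv_on `[0, T] (gd k) x (gd k.+1 x).
  by move=> kg xT; apply: dg.
have cgp : {within `[0, T], continuous (gd p : R -> R[i]^o)}.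
  (* For [p = gamma] continuity is given; for [p < gamma] it follows from differentiability. *)
  move: p_gamma; rewrite leq_eqVlt => /orP[/eqP -> //|pg].
  by apply: has_deriv_on_continuous => x xT; apply: dg.
set Mg := _ + _.
have sum_ge0 : 0 <= \sum_(0 <= l < p) cmod (gd l 0).
  by apply: sumr_ge0 => l _; exact: cmod_ge0.
have gp_le x : 0 <= x <= T -> cmod (gd p x) <= Mg.
  by move=> xT; apply: le_trans (sup_cmod_ge xT cgp) _; rewrite lerDr.
have Mg0 : 0 <= Mg by apply: le_trans (cmod_ge0 _) (gp_le 0 _); rewrite lexx ltW.
have sup0 : 0 <= sup_cmod T (gd p).
  by apply: le_trans (cmod_ge0 _) (sup_cmod_ge (x := 0) _ cgp); rewrite lexx ltW.
have g0_le k : (k < p)%N -> cmod (gd k 0) <= Mg.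
  move=> kp; apply: le_trans (_ : \sum_(0 <= l < p) cmod (gd l 0) <= _); last first.
    by rewrite lerDl.
  rewrite big_mkord (bigD1 (Ordinal kp)) //= lerDl.
  by apply: sumr_ge0 => l _; exact: cmod_ge0.
have dgp k x : (k < p)%N -> 0 <= x <= T -> has_deriv_on `[0, T] (gd k) x (gd k.+1 x).
  by move=> kp; apply: dgd; apply: leq_trans p_gamma.
have g_le := derivatives_bounded dgp g0_le gp_le.
have h0 : 0 <= h by rewrite divr_ge0 // ltW.
have L0 : 0 <= max_cmod s by rewrite /max_cmod bigmax_ge_id.
have C0 : 0 <= C T (max_cmod s).
  rewrite /C; apply: mulr_ge0; last by rewrite exprn_ge0 // addr_ge0 // mulr_ge0 // ltW.
  apply: mulr_ge0; first by rewrite mulr_ge0 ?(ltW T0) // (local_const_ge0 p resolvent_le).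
  by rewrite mulr_ge0 ?exprn_ge0 ?addr_ge0 ?mulr_ge0 ?expR_ge0 // ltW.
rewrite ger0_norm; last by rewrite /max_cmod bigmax_ge_id.
(* The maximum starts from [0], which also settles [P = 0], so the bound itself must be
   nonnegative. *)
apply: bigmax_le => [|l _]; first by rewrite mulr_ge0 // mulr_ge0 // exprn_ge0.
have sl : cmod (s l) <= max_cmod s by rewrite /max_cmod (le_bigmax _ (fun l => cmod (s l))).
have sh : cmod (s l * h%:C) <= 1.
  by apply: le_trans sh1; rewrite /max_cmod (le_bigmax _ (fun l => cmod (s l * h%:C))).
have := RK_global_error (g := gd) order_p nodes_in_01 Lstable.1
  (unitmx_resolvent eigenvalues_pos) resolvent_le
  T0 N0 (s0 l) sl sh dgp g_le (ode l) (rk l).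
move=> /le_trans; apply.
by rewrite le_eqVlt; apply/orP; left; apply/eqP; rewrite /C; ring.
Qed.
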